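(* There is an absolute constant $c>0$ such that for all integers $d\ge1$, all $0<\varepsilon\le1$ and all $u\in(0,1)$ the following holds. Put \[ N=\left\lceil\frac{49}{4}\bigl(d+\log((1-u)^{-1})+2\bigr)\varepsilon^{-2}\right\rceil . \] Then there is an integer $k\ge1$ with \[ k\le c\left(d(1+\log\varepsilon^{-1})+\log((1-u)^{-1})\right) \] such that any $k$-wise independent random points $\boldsymbol{X}_1,\ldots,\boldsymbol{X}_N$, each uniformly distributed on $[0,1)^d$, satisfy \[ D_N^*(\boldsymbol{X}_1,\ldots,\boldsymbol{X}_N)\le\varepsilon \] with probability at least $u$. In particular, for fixed $u$, this gives $N=O(d\varepsilon^{-2})$ and $k=O(d(1+\log\varepsilon^{-1}))$, with implied constants depending only on $u$.
   Context: $\log$ denotes the natural logarithm. For an $N$-point multiset $P=(\boldsymbol{x}_1,\ldots,\boldsymbol{x}_N)$ in $[0,1)^d$, the star discrepancy is \[ D_N^*(P)=\sup_{\boldsymbol{z}\in[0,1]^d}\left|\frac1N\sum_{n=1}^N\mathbf 1_{[\boldsymbol{0},\boldsymbol{z})}(\boldsymbol{x}_n)-\prod_{j=1}^d z_j\right|,\qquad [\boldsymbol{0},\boldsymbol{z})=\prod_{j=1}^d[0,z_j). \] Random vectors $\boldsymbol{X}_1,\ldots,\boldsymbol{X}_N$ are called $k$-wise independent if every subfamily of at most $k$ distinct vectors (i.e. vectors with distinct indices) is independent. *)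

(* Defs.v *)
From HB Require Import structures.
From mathcomp Require Import all_boot all_order all_algebra.
From mathcomp Require Import all_classical all_reals all_analysis.
Set Implicit Arguments.
Unset Strict Implicit.
Unset Printing Implicit Defensive.
Import Order.TTheory GRing.Theory Num.Theory.
Import numFieldNormedType.Exports.

Local Open Scope classical_set_scope.
Local Open Scope ring_scope.

(* Points of R^d are represented by d.-tuple R, which carries the sigma-algebra
   generated by the coordinate projections, i.e. the Borel sets of R^d. *)

Definition half_open_box (R : realType) (d : nat) (a b : d.-tuple R) :
    set (d.-tuple R) :=
  [set x | forall j : 'I_d, tnth a j <= tnth x j < tnth b j].

Definition origin_box (R : realType) (d : nat) (z : d.-tuple R) :
    set (d.-tuple R) :=
  half_open_box [tuple of nseq d 0] z.

Definition unit_cube (R : realType) (d : nat) : set (d.-tuple R) :=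
  origin_box [tuple of nseq d 1].

Definition closed_unit_cube (R : realType) (d : nat) : set (d.-tuple R) :=
  [set z | forall j : 'I_d, 0 <= tnth z j <= 1].

Arguments unit_cube : clear implicits.
Arguments closed_unit_cube : clear implicits.

(* The supremum is over a nonempty subset of R bounded by 1 (as soon as
   0 < N), so [sup] is the actual least upper bound. *)
Definition star_discrepancy (R : realType) (N d : nat)
    (x : 'I_N -> d.-tuple R) : R :=
  sup [set `| N%:R^-1 * (\sum_(n < N) \1_(origin_box z) (x n))
              - \prod_(j < d) tnth z j |
      | z in closed_unit_cube R d].

(* d-dimensional Lebesgue measure, as the iterated product of the
   one-dimensional one, transported along R * d.-tuple R -> d.+1.-tuple R. *)
Fixpoint lebesgue_measure_tuple (R : realType) (d : nat) :
    set (d.-tuple R) -> \bar R :=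
  match d with
  | 0 => \d_([tuple] : 0.-tuple R)
  | d'.+1 =>
      pushforward
        (product_measure1 (@lebesgue_measure R) (@lebesgue_measure_tuple R d'))
        (fun xt : measurableTypeR R * d'.-tuple R => [tuple of xt.1 :: xt.2])
  end.

Section random_points.
Context {R : realType} {dT : measure_display} {T : measurableType dT}
        (P : probability T R).

(* No normalization: the unit cube has Lebesgue measure 1. *)
Definition uniform_on_unit_cube (d : nat) (X : {RV P >-> d.-tuple R}) : Prop :=
  forall A : set (d.-tuple R), measurable A ->
    distribution P X A = lebesgue_measure_tuple (A `&` unit_cube R d).

Context {dS : measure_display} {S : measurableType dS} {I : finType}.

Definition independent_subfamily (X : I -> {RV P >-> S}) (J : {set I}) : Prop :=
  forall A : I -> set S, (forall i, measurable (A i)) ->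
    P (\bigcap_(i in [set` J]) (X i @^-1` A i))
    = (\prod_(i in J) P (X i @^-1` A i))%E.

Definition kwise_independent (k : nat) (X : I -> {RV P >-> S}) : Prop :=
  forall J : {set I}, (#|J| <= k)%N -> independent_subfamily X J.

End random_points.

(* The argument of the ceiling is positive for 0 < u < 1, hence the absolute
   value only serves to turn the ceiling into a natural number. *)
Definition num_points (R : realType) (d : nat) (eps u : R) : nat :=
  `| Num.ceil (49%:R / 4%:R * (d%:R + ln ((1 - u)^-1) + 2%:R) * eps ^- 2) |%N.

(* Main.v *)
Require Import Defs.
From HB Require Import structures.
From mathcomp Require Import all_boot all_order all_algebra.
From mathcomp Require Import all_classical all_reals all_analysis.
From mathcomp Require Import ring lra.
Import Order.TTheory GRing.Theory Num.Theory.
Import numFieldNormedType.Exports.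
Local Open Scope classical_set_scope.
Local Open Scope ring_scope.

(** Everything happens at the scale s = 2 eps / 7, for which N s^2 >= A with
    A = d + L + 2 and L = log (1/(1-u)); the target eps is 7/2 s.

    Limited independence.  For a measurable D, let S be the number of points
    in D and p their common probability of lying in D.  Expanding S^i over the
    maps from 'I_i to the indices shows that E[S^i] only involves the
    probabilities that at most i prescribed points lie in D, so k-wise
    independence gives every polynomial in S of degree at most k the same mean
    as for a binomial variable ([kwise_moment_eq]).  The polynomial
    (1 + x/m)^m + (1 - x/m)^m, with m even, stands in for the exponential in
    Chernoff's method: it is at most a constant times exp x + exp (-x), and for
    |x| <= m/99 it is at least exp (99/100 |x|).  Hence the deviations of S
    obey, up to these constants, the Hoeffding and Bernstein bounds valid for
    independent points, as soon as k exceeds a multiple of their exponent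
    ([kwise_weight_tail], [kwise_deviation_tail]).

    Bracketing.  In the grid of points rho^m, with m ranging over the vectors
    of naturals of sum at most M, every z of the cube has an upper neighbour;
    the largest m with z <= rho^m gives either a box of volume at most rho^M, or
    one whose lower neighbour rho^(m+1) is below z ([grid_bracket]).  There are
    'C(M + d, d) such points, that is exp (O(d)) for a fixed accuracy: counting
    by a simplex rather than by a cube of exponents is what avoids a factor
    log d in N ([bracketing_cover]).

    Chaining.  With accuracies 4^-(5+j), rounding z down level after level
    writes its box as a disjoint union of increments: a box at level 0, then
    differences of boxes of volume at most 4^-(4+j).  Hoeffding's bound at level
    0 and Bernstein's bound at the later levels, where the small variance pays
    for the larger number of grid points, allow errors of 12/5 s and
    O(j 2^-j) s.  Their sum and the last accuracy s/4 stay below 7/2 s, and the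
    failure probabilities add up to at most exp (-L) = 1 - u
    ([level_tail], [chaining], [star_discrepancy_tail]).  About log (1/eps)
    levels are needed, and the exponent at level j is O(d (1 + j) + L): hence
    the bound on k.

    The event is measurable because the supremum may be restricted to rational
    corners ([star_discrepancy_rationalP]). *)

(** * Exponential moments of a Bernoulli variable *)

Lemma expR_le_quad (R : realType) (x : R) : x <= 2^-1 ->
  expR x <= 1 + x + 2 * x ^+ 2.
Proof.
move=> hx.
have h1 : 0 < 1 - x by lra.
have h2 : expR x <= (1 - x)^-1.
  rewrite -[x in expR x]opprK expRN lef_pV2 ?posrE ?expR_gt0//.
  exact: expR_ge1Dx.
apply: (le_trans h2); rewrite -div1r ler_pdivrMr//; nra.
Qed.

(** Since 1 + y >= exp (y / (1 + y)), the power (1 + y)^m keeps the fraction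
    1 / (1 + y) of the exponent m y; the hypothesis makes y <= 1/99. *)
Lemma expR_le_powD1 (R : realType) (x0 : R) (m : nat) :
  (0 < m)%N -> 0 <= x0 -> 99 * x0 <= m%:R ->
  expR (99 / 100 * x0) <= (1 + x0 / m%:R) ^+ m.
Proof.
move=> m0 x0_ge0 hm.
have m_gt0 : 0 < m%:R :> R by rewrite ltr0n.
set y := x0 / m%:R.
have y0 : 0 <= y by rewrite divr_ge0.
have hy : 99 * y <= 1 by rewrite /y mulrA ler_pdivrMr// mul1r.
have -> : x0 = m%:R * y by rewrite /y mulrC divfK// gt_eqF.
have h : expR (99 / 100 * y) <= 1 + y.
  rewrite -[X in expR X]opprK expRN invf_ple ?posrE ?expR_gt0//; last by lra.
  apply: le_trans (expR_ge1Dx _); rewrite -div1r ler_pdivrMr; [nra|lra].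
have -> : 99 / 100 * (m%:R * y) = (99 / 100 * y) * m%:R by ring.
rewrite expRM_natr.
by apply: lerXn2r => //; rewrite nnegrE ?expR_ge0//; lra.
Qed.

(** The left-hand side is D l * exp (- l p) with D x = 1 - p + p exp x, and its
    quotient by exp (l^2 / 8) decreases on l >= 0: the derivative has the sign of
    - g, where g x = x/4 + p - p exp x / D x vanishes at 0 and is nondecreasing,
    because the derivative q (1 - q) of q = p exp x / D x is at most 1/4. *)
Lemma hoeffding_bernoulli_ge0 (R : realType) (p l : R) : 0 <= p <= 1 -> 0 <= l ->
  p * expR (l * (1 - p)) + (1 - p) * expR (- (l * p)) <= expR (l ^+ 2 / 8).
Proof.
move=> /andP[p0 p1] l0.
pose D (x : R) := 1 - p + p * expR x.
have D_gt0 x : 0 < D x.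
  rewrite /D; have [->|pn0] := eqVneq p 0; first by lra.
  by rewrite ltr_wpDl ?subr_ge0// mulr_gt0 ?expR_gt0// lt_neqAle eq_sym pn0.
have dD (x : R) : is_derive x (1:R) D (p * expR x).
  by rewrite /D; apply: is_derive_eq; rewrite /GRing.scale/=; ring.
pose g (x : R) := x / 4 + p - 1 + (1 - p) * (D x)^-1.
have dg (x : R) : is_derive x (1:R) g (4^-1 - p * expR x * (1 - p) / D x ^+ 2).
  have Dn0 : D x != 0 by rewrite gt_eqF.
  have dV : is_derive x 1 (fun y => (D y)^-1) (- (D x) ^- 2 *: (p * expR x)).
    exact: is_deriveV.
  rewrite /g; apply: is_derive_eq; rewrite /GRing.scale/=; field.
  exact: Dn0.
have g0 x : 0 <= x -> 0 <= g x.
  move=> x0; have <- : g 0 = 0.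
    by rewrite /g /D expR0 (_ : 1 - p + p * 1 = 1); [rewrite invr1; ring|ring].
  apply: (@ger0_derive1_ndecry _ g 0) => // [y _|].
  - rewrite derive1E; have -> := derive_val (is_derive := dg y).
    rewrite subr_ge0 ler_pdivrMr ?exprn_gt0//.
    have := sqr_ge0 (p * expR y - (1 - p)); rewrite /D; nra.
  - apply: derivable_within_continuous => y _.
    by have [] := dg y.
pose e (x : R) := - (x ^+ 2 / 8 + x * p).
have de (x : R) : is_derive x (1:R) e (- (x / 4 + p)).
  by rewrite /e; apply: is_derive_eq; rewrite /GRing.scale/=; field.
pose H x := D x * expR (e x).
have dH (x : R) : is_derive x (1:R) H (- (g x * D x * expR (e x))).
  rewrite /H; apply: is_derive_eq; rewrite /GRing.scale/= /g /D.
  by field; rewrite gt_eqF ?D_gt0.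
have H_le : H l <= H 0.
  apply: (@ler0_derive1_nincry _ H 0) => // [y|].
  - rewrite in_itv/= andbT => y0.
    rewrite derive1E; have -> := derive_val (is_derive := dH y).
    by rewrite oppr_le0 !mulr_ge0 ?expR_ge0 ?g0// ltW.
  - apply: derivable_within_continuous => y _.
    by have [] := dH y.
have {H_le} : H l <= 1.
  apply: (le_trans H_le); rewrite /H /D /e expR0 expr0n/= !mul0r addr0 oppr0 expR0; lra.
have -> : p * expR (l * (1 - p)) + (1 - p) * expR (- (l * p)) =
    H l * expR (l ^+ 2 / 8).
  rewrite /H -mulrA -expRD.
  have -> : e l + l ^+ 2 / 8 = - (l * p) by rewrite /e; ring.
  by rewrite mulrBr mulr1 /D expRD; ring.
by move=> H1; rewrite ler_piMl ?expR_ge0.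
Qed.

(** Exchanging the two values, l -> -l and p -> 1 - p, reduces to l >= 0. *)
Lemma hoeffding_bernoulli (R : realType) (p l : R) : 0 <= p <= 1 ->
  p * expR (l * (1 - p)) + (1 - p) * expR (- (l * p)) <= expR (l ^+ 2 / 8).
Proof.
move=> hp; have [l0|/ltW l0] := leP 0 l; first exact: hoeffding_bernoulli_ge0.
have hp' : 0 <= 1 - p <= 1 by lra.
have := @hoeffding_bernoulli_ge0 _ _ _ hp' (_ : 0 <= - l).
rewrite oppr_ge0 => /(_ l0); rewrite sqrrN; apply: le_trans.
have -> : 1 - (1 - p) = p by ring.
by rewrite !mulNr opprK addrC.
Qed.

(** The variant that profits from a small p: from 1 + p (exp l - 1) <=
    exp (p (exp l - 1)), the centred exponent is p (exp l - 1 - l) <= 2 p l^2. *)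
Lemma bernstein_bernoulli (R : realType) (p l : R) : 0 <= p <= 1 -> l <= 2^-1 ->
  p * expR (l * (1 - p)) + (1 - p) * expR (- (l * p)) <= expR (2 * p * l ^+ 2).
Proof.
move=> /andP[p0 p1] hl.
have -> : p * expR (l * (1 - p)) + (1 - p) * expR (- (l * p)) =
    expR (- (l * p)) * (1 + p * (expR l - 1)).
  by rewrite mulrBr mulr1 expRD; ring.
have h : 1 + p * (expR l - 1) <= expR (p * (l + 2 * l ^+ 2)).
  apply: le_trans (expR_ge1Dx _); rewrite lerD2l ler_wpM2l// lerBlDl addrA.
  exact: expR_le_quad.
have -> : 2 * p * l ^+ 2 = - (l * p) + p * (l + 2 * l ^+ 2) by ring.
by rewrite expRD ler_wpM2l ?expR_ge0.
Qed.

(** * Polynomial moments under limited independence *)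

(** The law of the random subset of I containing each index independently with
    probability p. *)
Definition bernoulli_weight {R : pzRingType} {I : finType} (p : R) (y : {set I}) : R :=
  \prod_i (if i \in y then p else 1 - p).

Lemma bernoulli_weight_superset (R : comNzRingType) (I : finType) (p : R) (J : {set I}) :
  \sum_(y : {set I} | J \subset y) bernoulli_weight p y = p ^+ #|J|.
Proof.
transitivity (\prod_i (p + (if i \in J then 0 else 1 - p))); last first.
  rewrite (eq_bigr (fun i => if i \in J then p else 1)); last first.
    by move=> i _; case: ifP => _; rewrite ?addr0// addrC subrK.
  by rewrite -big_mkcond prodr_const.
rewrite (bigA_distr _ _ (fun i : I => p)).
rewrite [LHS]big_mkcond; apply: eq_bigr => y _.
case: ifPn => [Jy|/fintype.subsetPn[i iJ iy]].
  apply: eq_bigr => i _; case: ifPn => // iy; case: ifPn => // iJ.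
  by move: iy; rewrite (fintype.subsetP Jy).
by rewrite (bigD1 i)//= (negPf iy) iJ mul0r.
Qed.

Lemma bernoulli_weight_mgf (R : realType) (I : finType) (p l : R) :
  \sum_(y : {set I}) bernoulli_weight p y * expR (l * (#|y|%:R - #|I|%:R * p)) =
  (p * expR (l * (1 - p)) + (1 - p) * expR (- (l * p))) ^+ #|I|.
Proof.
rewrite -prodr_const (bigA_distr _ _ (fun i : I => p * expR (l * (1 - p)))).
apply: eq_bigr => y _.
rewrite (eq_bigr (fun i => (if i \in y then p else 1 - p) *
   (if i \in y then expR (l * (1 - p)) else expR (- (l * p))))); last first.
  by move=> i _; case: ifP.
rewrite big_split /=; congr (_ * _).
rewrite (eq_bigr (fun i => expR (if i \in y then l * (1-p) else - (l * p)))); last first.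
  by move=> i _; case: ifP.
rewrite -expR_sum; congr expR.
rewrite (eq_bigr (fun i => (if i \in y then l else 0) + (- (l * p)))); last first.
  by move=> i _; case: ifP => _; ring.
rewrite big_split /= -big_mkcond !sumr_const -(mulr_natr l) -(mulr_natr (- (l * p))); ring.
Qed.

Lemma bernoulli_weight_ge0 (R : numDomainType) (I : finType) (p : R) (y : {set I}) :
  0 <= p <= 1 -> 0 <= bernoulli_weight p y.
Proof.
by move=> /andP[p0 p1]; apply: prodr_ge0 => i _; case: ifP; rewrite ?subr_ge0.
Qed.

(** The two sides count the maps from 'I_i to y. *)
Lemma card_pow_maps (R : pzSemiRingType) (I : finType) (i : nat) (y : {set I}) :
  #|y|%:R ^+ i = \sum_(f : {ffun 'I_i -> I} | (f @: 'I_i) \subset y) 1 :> R.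
Proof.
rewrite sumr_const -natrX; congr (_%:R).
rewrite -[in LHS](card_ord i) -card_ffun_on; apply: eq_card => f.
rewrite [RHS]unfold_in /=; apply/ffun_onP/fintype.subsetP => /= [h j /imsetP[a _ ->] //|h a].
by apply: h; apply: imset_f.
Qed.

(** A map f : 'I_i -> I has its values in y iff y contains the image of f, a set
    of at most i elements; so the i-th moment of #|y| depends on W only through
    the sums over supersets of sets of size at most i. *)
Lemma kwise_moment_eq (R : comNzRingType) (I : finType) (W W' : {set I} -> R) (k : nat) :
  (forall J : {set I}, (#|J| <= k)%N ->
     \sum_(y : {set I} | J \subset y) W y = \sum_(y : {set I} | J \subset y) W' y) ->
  forall Q : {poly R}, (size Q <= k.+1)%N ->
  \sum_(y : {set I}) W y * Q.[#|y|%:R] = \sum_(y : {set I}) W' y * Q.[#|y|%:R].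
Proof.
move=> WW' Q sQ.
have mom i : (i <= k)%N ->
    \sum_(y : {set I}) W y * #|y|%:R ^+ i = \sum_(y : {set I}) W' y * #|y|%:R ^+ i.
  move=> ik.
  have E (V : {set I} -> R) : \sum_(y : {set I}) V y * #|y|%:R ^+ i =
      \sum_(f : {ffun 'I_i -> I}) \sum_(y : {set I} | (f @: 'I_i) \subset y) V y.
    rewrite (exchange_big_dep predT)//=; apply: eq_bigr => y _.
    by rewrite card_pow_maps mulr_sumr; apply: eq_bigr => f _; rewrite mulr1.
  rewrite !E; apply: eq_bigr => f _; apply: WW'.
  by rewrite (leq_trans (leq_imset_card _ _))// card_ord.
have E (V : {set I} -> R) : \sum_(y : {set I}) V y * Q.[#|y|%:R] =
    \sum_(i < size Q) Q`_i * \sum_(y : {set I}) V y * #|y|%:R ^+ i.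
  under eq_bigr => y _ do rewrite horner_coef mulr_sumr.
  rewrite exchange_big/=; apply: eq_bigr => i _; rewrite mulr_sumr.
  by apply: eq_bigr => y _; rewrite mulrCA.
rewrite !E; apply: eq_bigr => i _; rewrite mom//.
by rewrite -ltnS (leq_trans (ltn_ord i)).
Qed.

Lemma pow1D_le_expR_sum (R : realType) (m : nat) (x : R) :
  (1 + x / m%:R) ^+ m <= expR x + expR (- x).
Proof.
have [->|m0] := posnP m.
  by rewrite expr0; have := expR_ge1Dx x; have := expR_ge1Dx (- x); lra.
have m_gt0 : 0 < m%:R :> R by rewrite ltr0n.
have h : (1 + x / m%:R) ^+ m <= expR `|x|.
  rewrite (le_trans (ler_norm _))// normrX.
  rewrite -[in leRHS](divfK (lt0r_neq0 m_gt0) `|x|) expRM_natr.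
  apply: lerXn2r; rewrite ?nnegrE ?expR_ge0//.
  rewrite (le_trans (ler_normD _ _))// normr1 (le_trans _ (expR_ge1Dx _))//.
  by rewrite normrM normfV normr_nat.
apply: (le_trans h).
by case: ger0P => _; rewrite ?lerDl ?lerDr expR_ge0.
Qed.

(** A polynomial of degree m that behaves like exp (l x) + exp (- l x) in
    x = X - a; both signs are kept so as to control both tails at once. *)
Definition deviation_poly {R : realType} (m : nat) (a l : R) : {poly R} :=
  (1 + (l / m%:R) *: ('X - a%:P)) ^+ m + (1 - (l / m%:R) *: ('X - a%:P)) ^+ m.

Lemma size_deviation_poly (R : realType) m (a l : R) : (size (deviation_poly m a l) <= m.+1)%N.
Proof.
have sz (b : R) : (size ((1 + b *: ('X - a%:P)) ^+ m)%R <= m.+1)%N.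
  have s2 : (size ((1 + b *: ('X - a%:P))%R : {poly R}) <= 2)%N.
    rewrite (leq_trans (size_polyD _ _))// geq_max size_poly1/=.
    by rewrite (leq_trans (size_scale_leq _ _))// size_XsubC.
  rewrite (leq_trans (size_poly_exp_leq _ _))// ltnS.
  by rewrite -[X in (_ <= X)%N]mul1n leq_mul// -subn1 leq_subLR.
rewrite /deviation_poly (leq_trans (size_polyD _ _))// geq_max sz/=.
by rewrite -scaleNr sz.
Qed.

Lemma deviation_polyE (R : realType) m (a l x : R) :
  (deviation_poly m a l).[x] =
  (1 + (l * (x - a)) / m%:R) ^+ m + (1 + - (l * (x - a)) / m%:R) ^+ m.
Proof.
rewrite /deviation_poly hornerD !horner_exp !hornerE /=.
by congr (_ ^+ _ + _ ^+ _); ring.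
Qed.

(** * Deviation bounds under limited independence *)

(** Markov's inequality for the deviation polynomial Q: its mean under W equals
    its mean under the Bernoulli weights, where the product formula for the
    exponential moments applies.  Of the factor 4, one 2 comes from
    Q <= 2 (exp + exp), the other from the two signs of l. *)
Lemma kwise_weight_tail (R : realType) (I : finType) (W : {set I} -> R)
    (k m : nat) (p l b tau : R) :
  (forall y, 0 <= W y) ->
  (forall J : {set I}, (#|J| <= k)%N ->
     \sum_(y : {set I} | J \subset y) W y = p ^+ #|J|) ->
  0 <= p <= 1 -> ~~ odd m -> (0 < m <= k)%N -> 0 <= l -> 0 <= tau ->
  99 * (l * tau) <= m%:R ->
  (forall l', `|l'| = l ->
    p * expR (l' * (1 - p)) + (1 - p) * expR (- (l' * p)) <= expR b) ->
  \sum_(y : {set I} | tau < `|#|y|%:R - #|I|%:R * p|) W y <=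
    4 * expR (#|I|%:R * b - 99 / 100 * (l * tau)).
Proof.
move=> W0 Wp p01 m_even /andP[m_gt0 mk] l0 tau0 hm hb.
set N := #|I|; set a := N%:R * p.
pose Q := deviation_poly m a l.
pose F0 := expR (99 / 100 * (l * tau)).
have m0 : 0 < m%:R :> R by rewrite ltr0n.
have even_ge0 (x : R) : 0 <= x ^+ m by apply: exprn_even_ge0.
have Q_ge0 y : 0 <= Q.[y] by rewrite deviation_polyE addr_ge0.
have Q_large (y : R) : tau < `|y - a| -> F0 <= Q.[y].
  move=> hy; rewrite deviation_polyE.
  apply: (le_trans (expR_le_powD1 _ _ _ m_gt0 (mulr_ge0 l0 tau0) hm)).
  have h (x : R) : l * tau <= x -> (1 + l * tau / m%:R) ^+ m <= (1 + x / m%:R) ^+ m.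
    move=> hx; apply: lerXn2r; rewrite ?nnegrE ?lerD2l ?ler_pM2r ?invr_gt0//.
      by rewrite addr_ge0// divr_ge0// ?mulr_ge0// ltW.
    by rewrite addr_ge0// divr_ge0// ?(le_trans _ hx) ?mulr_ge0// ltW.
  move: hy; case: (ger0P (y - a)) => _ hy.
    by rewrite -[leLHS]addr0 lerD ?h// ler_wpM2l// ltW.
  by rewrite -[leLHS]add0r lerD ?h// -mulrN ler_wpM2l// ltW.
have Q_le y : Q.[y] <= 2 * (expR (l * (y - a)) + expR (- l * (y - a))).
  have := pow1D_le_expR_sum R m (l * (y - a)).
  have := pow1D_le_expR_sum R m (- (l * (y - a))).
  rewrite deviation_polyE (mulNr l) opprK; lra.
have markov : F0 * \sum_(y : {set I} | tau < `|#|y|%:R - a|) W y <=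
    \sum_(y : {set I}) W y * Q.[#|y|%:R].
  rewrite mulr_sumr [leLHS]big_mkcond ler_sum// => y _.
  by case: ifPn => hy; rewrite ?mulr_ge0// mulrC ler_wpM2l ?Q_large.
have transfer : \sum_(y : {set I}) W y * Q.[#|y|%:R] =
    \sum_(y : {set I}) bernoulli_weight p y * Q.[#|y|%:R].
  apply: (@kwise_moment_eq _ _ _ _ m) => [J hJ|]; last exact: size_deviation_poly.
  by rewrite bernoulli_weight_superset Wp// (leq_trans hJ).
have mgf l' : `|l'| = l ->
    \sum_(y : {set I}) bernoulli_weight p y * expR (l' * (#|y|%:R - a)) <= expR (N%:R * b).
  move=> hl'; rewrite bernoulli_weight_mgf (mulrC N%:R) expRM_natr.
  apply: lerXn2r; rewrite ?nnegrE ?expR_ge0 ?hb//.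
  by case/andP: p01 => p0 p1; rewrite addr_ge0// mulr_ge0 ?expR_ge0// subr_ge0.
have main : F0 * \sum_(y : {set I} | tau < `|#|y|%:R - a|) W y <= 4 * expR (N%:R * b).
  rewrite (le_trans markov)// transfer.
  apply: (@le_trans _ _ (\sum_(y : {set I}) bernoulli_weight p y *
      (2 * (expR (l * (#|y|%:R - a)) + expR (- l * (#|y|%:R - a)))))).
    by apply: ler_sum => y _; rewrite ler_wpM2l ?bernoulli_weight_ge0.
  under eq_bigr => y _ do rewrite mulrCA mulrDr.
  rewrite -mulr_sumr big_split/=.
  have := mgf l (ger0_norm l0); have := mgf (- l); rewrite normrN => /(_ (ger0_norm l0)).
  lra.
have F0_gt0 : 0 < F0 by exact: expR_gt0.
rewrite -(ler_pM2l F0_gt0) (le_trans main)//.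
by rewrite mulrCA /F0 -expRD addrCA subrr addr0.
Qed.

Lemma measure_finite_fibers (dT : measure_display) (T : measurableType dT) (R : realType)
    (P : probability T R) (F : finType) (Y : T -> F) (Q : pred F) :
  (forall y, measurable (Y @^-1` [set y])) ->
  measurable [set t | Q (Y t)] /\
  P [set t | Q (Y t)] = (\sum_(y | Q y) P (Y @^-1` [set y]))%E.
Proof.
move=> mY.
have E : [set t | Q (Y t)] = \bigcup_(y in [set` Q]) (Y @^-1` [set y]).
  apply/seteqP; split => [t /= Qt|t [y /= Qy]]; [by exists (Y t)|by move=> /= ->].
have fQ : finite_set [set` Q] by [].
rewrite E; split; first exact: fin_bigcup_measurable.
rewrite measure_fin_bigcup//; last by move=> i j _ _ [t [/= <- <-]].
by rewrite -(@bigfs _ _ _ _ (index_enum F) Q) ?index_enum_uniq// => i _; rewrite mem_index_enum.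
Qed.

Definition hits {T S : Type} {I : finType} (X : I -> T -> S) (D : set S) (t : T) : {set I} :=
  [set i | X i t \in D]%SET.

Lemma card_hits (R : pzRingType) (T S : Type) (I : finType) (X : I -> T -> S)
    (D : set S) (t : T) :
  #|hits X D t|%:R = \sum_i \1_D (X i t) :> R.
Proof.
rewrite -sum1_card natr_sum big_mkcond; apply: eq_bigr => i _.
by rewrite inE indicE; case: ifP.
Qed.

(** The set of indices whose point falls in D takes finitely many values; each
    fibre is a finite intersection of preimages of D and of its complement. *)
Lemma measurable_hits (dT : measure_display) (T : measurableType dT)
    (dS : measure_display) (S : measurableType dS) (I : finType)
    (X : I -> {mfun T >-> S}) (D : set S) (y : {set I}) :
  measurable D -> measurable (hits X D @^-1` [set y]).
Proof.
move=> mD.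
have mX i : measurable (X i @^-1` D).
  by rewrite -[X in measurable X]setTI; apply: measurable_funP.
have -> : hits X D @^-1` [set y] =
    \bigcap_(i in [set: I]) (if i \in y then X i @^-1` D else ~` (X i @^-1` D)).
  apply/seteqP; split => t /=.
    move=> <- i _; rewrite inE; case: ifPn; first by rewrite inE.
    by rewrite notin_setE.
  move=> h; apply/setP => i; rewrite inE.
  have := h i Logic.I; case: ifPn => _ /= Xit; first exact: mem_set.
  exact: memNset.
apply: fin_bigcap_measurable => // i _.
by case: ifP => _ //; exact: measurableC.
Qed.

(** The law of the set of indices hitting D is a weight on {set I}, whose sums
    over supersets of small sets are given by k-wise independence. *)
Lemma kwise_deviation_tail (R : realType) (dT : measure_display) (T : measurableType dT)
    (P : probability T R) (dS : measure_display) (S : measurableType dS) (I : finType)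
    (X : I -> {RV P >-> S}) (D : set S) (k m : nat) (p l b tau : R) :
  kwise_independent k X -> measurable D ->
  (forall i, P (X i @^-1` D) = p%:E) ->
  ~~ odd m -> (0 < m <= k)%N -> 0 <= l -> 0 <= tau ->
  99 * (l * tau) <= m%:R -> 0 <= p <= 1 ->
  (forall l', `|l'| = l ->
    p * expR (l' * (1 - p)) + (1 - p) * expR (- (l' * p)) <= expR b) ->
  let B := [set t | tau < `|\sum_i \1_D (X i t) - #|I|%:R * p|] in
  measurable B /\
  (P B <= (4 * expR (#|I|%:R * b - 99 / 100 * (l * tau)))%:E)%E.
Proof.
move=> kX mD pD m_even mk l0 tau0 hm p01 hb B.
pose Y := hits X D.
have mY y : measurable (Y @^-1` [set y]) by exact: measurable_hits.
pose W (y : {set I}) := fine (P (Y @^-1` [set y])).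
have WE y : P (Y @^-1` [set y]) = (W y)%:E.
  by rewrite fineK// fin_num_measure.
have BE : B = [set t | tau < `|#|Y t|%:R - #|I|%:R * p|].
  by apply/seteqP; split => t /=; rewrite card_hits.
have [mB PB] := measure_finite_fibers _ _ _ P _ Y
  (fun y => tau < `|#|y|%:R - #|I|%:R * p|) mY.
rewrite BE; split => //; rewrite PB.
under eq_bigr => y _ do rewrite WE.
rewrite sumEFin lee_fin.
apply: (kwise_weight_tail _ _ _ k m) => // [y|J hJ].
  exact: fine_ge0.
have [_ PJ] := measure_finite_fibers _ _ _ P _ Y (fun y => J \subset y) mY.
apply: EFin_inj; rewrite -sumEFin.
under eq_bigr => y _ do rewrite -WE.
rewrite -PJ.
have -> : [set t | J \subset Y t] = \bigcap_(i in [set` J]) (X i @^-1` D).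
  apply/seteqP; split => t /=.
    by move=> /fintype.subsetP h i /= /h; rewrite !inE.
  by move=> h; apply/fintype.subsetP => i /h; rewrite !inE.
rewrite (kX J hJ (fun=> D))// (eq_bigr (fun=> p%:E)) => [|i _]; last exact: pD.
by rewrite prodEFin prodr_const.
Qed.

(** * Lebesgue measure of boxes *)

Lemma lebesgue_measure_tuple0 (R : realType) (d : nat) :
  lebesgue_measure_tuple (set0 : set (d.-tuple R)) = 0%E.
Proof.
elim: d => [|d IH] /=; first by rewrite diracE in_set0.
rewrite /pushforward preimage_set0 /product_measure1.
rewrite integral0_eq// => x _ /=.
by rewrite xsection0 IH.
Qed.

(** Sections of a box along the first coordinate are either empty or the box of
    the remaining coordinates. *)
Lemma lebesgue_measure_tuple_box (R : realType) (d : nat) (a b : d.-tuple R) :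
  (forall j, tnth a j <= tnth b j) ->
  lebesgue_measure_tuple (half_open_box a b) = (\prod_(j < d) (tnth b j - tnth a j))%:E.
Proof.
elim: d a b => [|d IH] a b ab /=.
  by rewrite big_ord0 diracE mem_set//= => -[].
have cons_ex (t : d.+1.-tuple R) : exists t0 (t' : d.-tuple R), t = [tuple of t0 :: t'].
  by case/tupleP: t => t0 t'; exists t0, t'.
have [a0 [a' ?]] := cons_ex a; have [b0 [b' ?]] := cons_ex b; subst a b.
move: a' b' ab => a b ab.
have ab0 : a0 <= b0 by have := ab ord0; rewrite !tnth0.
have ab' j : tnth a j <= tnth b j by have := ab (lift ord0 j); rewrite !tnthS.
rewrite /pushforward /product_measure1.
have E x : lebesgue_measure_tuple (xsection ((fun xt : measurableTypeR R * d.-tuple R =>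
    [tuple of xt.1 :: xt.2]) @^-1` half_open_box [tuple of a0 :: a] [tuple of b0 :: b]) x) =
   (cst (\prod_(j < d) (tnth b j - tnth a j))%:E \_ `[a0, b0[) x.
  rewrite patchE; case: ifPn => x0.
    rewrite /= -IH//; congr lebesgue_measure_tuple.
    apply/seteqP; split => t; rewrite /xsection/= inE/=.
      by move=> h j; have := h (lift ord0 j); rewrite !tnthS.
    move=> h j; case: (unliftP ord0 j) => [i|] ->; rewrite ?tnthS ?tnth0 ?h//.
    by move: x0; rewrite inE/= in_itv.
  rewrite -[RHS](lebesgue_measure_tuple0 R d); congr lebesgue_measure_tuple.
  apply/seteqP; split => t //; rewrite /xsection/= inE/= => h.
  by move: x0; rewrite notin_setE/= in_itv/=; have := h ord0; rewrite !tnth0 => ->.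
transitivity (\int[@lebesgue_measure R]_x
    (cst (\prod_(j < d) (tnth b j - tnth a j))%:E \_ `[a0, b0[) x)%E.
  by apply: eq_integral => x _; exact: E.
rewrite -integral_mkcond integral_cst//= lebesgue_measure_itv/= lte_fin.
rewrite big_ord_recl !tnth0 mulrC EFinM; congr (_ * _)%E.
  by congr EFin; apply: eq_bigr => j _; rewrite !tnthS.
case: ltP => // h; suff -> : a0 = b0 by rewrite subrr.
by apply/le_anti; rewrite ab0 h.
Qed.

Lemma origin_box_sub_unit_cube (R : realType) (d : nat) (z : d.-tuple R) :
  closed_unit_cube R d z -> origin_box z `<=` unit_cube R d.
Proof.
move=> hz x hx j; have /andP[h1 h2] := hx j; have /andP[_ h3] := hz j.
by rewrite h1/= tnth_nseq (lt_le_trans h2).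
Qed.

Lemma measurable_origin_box (R : realType) (d : nat) (z : d.-tuple R) :
  measurable (origin_box z).
Proof.
have -> : origin_box z =
    \bigcap_(j in [set: 'I_d]) ((fun x => tnth x j) @^-1` `[0, tnth z j[%classic).
  apply/seteqP; split => x /=.
    by move=> h j _ /=; have := h j; rewrite tnth_nseq in_itv.
  by move=> h j; have := h j Logic.I; rewrite /= tnth_nseq in_itv.
apply: fin_bigcap_measurable => // j _.
rewrite -[X in measurable X]setTI.
exact: (measurable_tnth j measurableT (measurable_itv `[0, tnth z j[)).
Qed.

Lemma uniform_origin_box (R : realType) (dT : measure_display) (T : measurableType dT)
    (P : probability T R) (d : nat) (X : {RV P >-> d.-tuple R}) (z : d.-tuple R) :
  uniform_on_unit_cube X -> closed_unit_cube R d z ->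
  P (X @^-1` origin_box z) = (\prod_(j < d) tnth z j)%:E.
Proof.
move=> uX hz.
have := uX _ (measurable_origin_box R d z).
rewrite setIidl; last exact: origin_box_sub_unit_cube.
rewrite /origin_box lebesgue_measure_tuple_box => [|j]; last first.
  by rewrite tnth_nseq; have /andP[] := hz j.
rewrite /distribution/= /pushforward => ->; congr EFin.
by apply: eq_bigr => j _; rewrite tnth_nseq subr0.
Qed.

(** * The star discrepancy as a supremum over rational corners *)

Definition local_discrepancy {R : realType} {N d : nat} (x : 'I_N -> d.-tuple R)
    (z : d.-tuple R) : R :=
  N%:R^-1 * (\sum_(n < N) \1_(origin_box z) (x n)) - \prod_(j < d) tnth z j.

Lemma prod_01 (R : numDomainType) (I : finType) (f : I -> R) :
  (forall j, 0 <= f j <= 1) -> 0 <= \prod_j f j <= 1.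
Proof.
move=> h; apply/andP; split; first by apply: prodr_ge0 => j _; case/andP: (h j).
by apply: prodr_ile1 => j _.
Qed.

Lemma mean_indic_01 (R : realType) (N d : nat) (x : 'I_N -> d.-tuple R) (D : set (d.-tuple R)) :
  0 <= (N%:R^-1 * (\sum_(n < N) \1_D (x n)) : R) <= 1.
Proof.
have S0 : 0 <= \sum_(n < N) \1_D (x n) :> R by apply: sumr_ge0.
rewrite mulr_ge0 ?invr_ge0//=.
case: N x S0 => [|N] x S0; first by rewrite invr0 mul0r.
rewrite ler_pdivrMl ?ltr0n// mulr1.
have -> : N.+1%:R = \sum_(n < N.+1) 1 :> R by rewrite sumr_const card_ord.
by apply: ler_sum => n _; rewrite indicE; case: (_ \in _).
Qed.

Lemma star_discrepancy_leP (R : realType) (N d : nat) (x : 'I_N -> d.-tuple R) (eps : R) :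
  star_discrepancy x <= eps <->
  (forall z, closed_unit_cube R d z -> `|local_discrepancy x z| <= eps).
Proof.
split=> [h z hz|h].
  apply: le_trans h; apply: ub_le_sup; last by exists z.
  exists 2 => _ [y hy <-].
  have := mean_indic_01 _ _ _ x (origin_box y).
  have := prod_01 _ _ (fun j => tnth y j) hy.
  by rewrite ler_norml => /andP[? ?] /andP[? ?]; lra.
apply: ge_sup; last by move=> _ [z hz <-]; exact: h.
exists `|local_discrepancy x [tuple of nseq d 0]|; exists [tuple of nseq d 0] => //.
by move=> j; rewrite tnth_nseq lexx ler01.
Qed.

(** Telescoping: f F - g G = (f - g) F + g (F - G), all factors being in [0, 1]. *)
Lemma ler_dist_prod (R : numDomainType) (I : finType) (f g : I -> R) :
  (forall j, 0 <= f j <= 1) -> (forall j, 0 <= g j <= 1) ->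
  `|\prod_j f j - \prod_j g j| <= \sum_j `|f j - g j|.
Proof.
move=> hf hg; elim: (index_enum I) => [|i r IH]; first by rewrite !big_nil subrr normr0.
rewrite !big_cons.
have -> : f i * \prod_(j <- r) f j - g i * \prod_(j <- r) g j =
    (f i - g i) * \prod_(j <- r) f j + g i * (\prod_(j <- r) f j - \prod_(j <- r) g j).
  by ring.
apply: (le_trans (ler_normD _ _)); rewrite !normrM lerD//.
  rewrite ler_piMr// ger0_norm.
    by apply: prodr_ile1 => j _.
  by apply: prodr_ge0 => j _; case/andP: (hf j).
apply: le_trans IH; rewrite ler_piMl//.
by case/andP: (hg i) => g0 g1; rewrite ger0_norm.
Qed.

(** For a finite set of reals x n, a small move of z > 0 to the left does not
    change which of them are below z; when z = 0 no move is needed. *)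
Lemma left_rational (R : realType) (N : nat) (x : 'I_N -> R) (z eta : R) :
  0 <= z -> 0 < eta ->
  exists q : rat, [/\ 0 <= (ratr q : R) <= z, z - ratr q <= eta &
    forall n, (x n < z) = (x n < ratr q)].
Proof.
move=> z0 eta0; have [zp|] := ltP 0 z; last first.
  move=> zn; have {zn z0} -> : z = 0 by apply/le_anti; rewrite zn z0.
  by exists 0; rewrite rmorph0 lexx subr0 ltW.
(* Any rational strictly between l and z will do. *)
pose l := \big[Order.max/Order.max 0 (z - eta)]_(n < N | x n < z) x n.
have lz : l < z.
  by apply: bigmax_lt => //; rewrite gt_max zp ltrBlDr ltrDl.
have [q /[!in_itv]/= /andP[lq qz]] := rat_in_itvoo lz.
have l0 : Order.max 0 (z - eta) <= l by exact: bigmax_ge_id.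
move: l0; rewrite ge_max => /andP[l0 l1].
exists q; split.
- by rewrite (le_trans l0 (ltW lq)) ltW.
- by rewrite lerBlDr -lerBlDl (le_trans l1 (ltW lq)).
- move=> n; apply/idP/idP => [h|/lt_trans->//].
  by apply: le_lt_trans lq; exact: le_bigmax_cond.
Qed.

(** Moving the corner slightly to the left to a rational one keeps the same
    sample points in the box and hardly changes the volume. *)
Lemma local_discrepancy_rational (R : realType) (N d : nat) (x : 'I_N -> d.-tuple R)
    (z : d.-tuple R) (eta : R) :
  closed_unit_cube R d z -> 0 < eta ->
  exists2 q : d.-tuple rat, closed_unit_cube R d (map_tuple ratr q) &
    `|local_discrepancy x z| <= `|local_discrepancy x (map_tuple ratr q)| + eta.
Proof.
move=> hz eta0.
have eta'0 : 0 < eta / d.+1%:R by rewrite divr_gt0.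
have [f hf] := fin_all_exists (fun j : 'I_d =>
  left_rational R N (fun n => tnth (x n) j) (tnth z j) (eta / d.+1%:R)
    (proj1 (andP (hz j))) eta'0).
pose q := [tuple f j | j < d]; pose w : d.-tuple R := map_tuple ratr q.
have wE j : tnth w j = ratr (f j) by rewrite tnth_map tnth_mktuple.
have hw : closed_unit_cube R d w.
  move=> j; have [/andP[h1 h2] _ _] := hf j; have /andP[_ h3] := hz j.
  by rewrite wE h1 (le_trans h2).
exists q => //; rewrite -/w.
have box n : origin_box z (x n) = origin_box w (x n).
  apply/propext; split => h j; have := h j; have [_ _ /(_ n) E] := hf j.
    by rewrite E wE.
  by rewrite wE -E.
have -> : local_discrepancy x z =
    local_discrepancy x w + (\prod_(j < d) tnth w j - \prod_(j < d) tnth z j).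
  rewrite /local_discrepancy addrA subrK; congr (_ * _ - _).
  apply: eq_bigr => n _; rewrite !indicE; congr (nat_of_bool _)%:R.
  by apply/idP/idP; rewrite !inE box.
rewrite (le_trans (ler_normD _ _))// lerD2l.
rewrite (le_trans (ler_dist_prod _ _ _ _ hw hz))//.
apply: (@le_trans _ _ (\sum_(j < d) eta / d.+1%:R)).
  apply: ler_sum => j _; have [/andP[_ h2] h3 _] := hf j.
  by rewrite wE distrC ger0_norm ?subr_ge0.
rewrite sumr_const card_ord -[_ *+ d]mulr_natr mulrAC -mulrA ler_piMr ?(ltW eta0)//.
by rewrite ler_pdivrMr// mul1r ler_nat.
Qed.

Lemma star_discrepancy_rationalP (R : realType) (N d : nat) (x : 'I_N -> d.-tuple R) (eps : R) :
  star_discrepancy x <= eps <->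
  (forall q : d.-tuple rat, closed_unit_cube R d (map_tuple ratr q) ->
     `|local_discrepancy x (map_tuple ratr q)| <= eps).
Proof.
split=> [/star_discrepancy_leP h q hq|h]; first exact: h.
apply/star_discrepancy_leP => z hz; apply/ler_addgt0Pr => eta eta0.
have [q hq] := local_discrepancy_rational _ _ _ x z eta hz eta0.
by move/le_trans; apply; rewrite lerD2r h.
Qed.

Lemma measurable_star_discrepancy_le (R : realType) (dT : measure_display)
    (T : measurableType dT) (N d : nat) (X : 'I_N -> {mfun T >-> d.-tuple R}) (eps : R) :
  measurable [set t | star_discrepancy (fun n => X n t) <= eps].
Proof.
pose F (q : d.-tuple rat) : set T := [set t | closed_unit_cube R d (map_tuple ratr q) ->
     `|local_discrepancy (fun n => X n t) (map_tuple ratr q)| <= eps].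
have -> : [set t | star_discrepancy (fun n => X n t) <= eps] = ~` \bigcup_q ~` F q.
  rewrite setC_bigcup; apply/seteqP; split => t /=.
    by move=> /star_discrepancy_rationalP h q _; rewrite setCK => hq; exact: h.
  move=> h; apply/star_discrepancy_rationalP => q hq.
  by have := h q Logic.I; rewrite setCK; apply.
apply: measurableC; apply: countable_bigcupT_measurable; first exact: countableP.
move=> q; apply: measurableC; set w : d.-tuple R := map_tuple ratr q.
have [hw|hw] := pselect (closed_unit_cube R d w); last first.
  by rewrite (_ : F q = setT)//; apply/seteqP; split => t // _ /hw.
pose Q (y : {set 'I_N}) := `|N%:R^-1 * #|y|%:R - \prod_(j < d) tnth w j| <= eps.
have -> : F q = \bigcup_(y in [set` Q]) (hits X (origin_box w) @^-1` [set y]).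
  apply/seteqP; split => t; rewrite /F/= /local_discrepancy.
    move=> /(_ hw) h; exists (hits X (origin_box w) t) => //=.
    by rewrite unfold_in /Q card_hits.
  by move=> [y /= hy E _]; move: hy; rewrite -E unfold_in /Q card_hits.
apply: fin_bigcup_measurable => // y _.
by apply: measurable_hits; exact: measurable_origin_box.
Qed.

(** * Bracketing covers of the cube *)

(** From exp (1/8) >= 9/8; the constant is what [grid_count_bound] needs. *)
Lemma expR1_ge (R : realType) : 256 / 100 <= expR 1 :> R.
Proof.
have -> : 1 = 8^-1 * 8%:R :> R by rewrite mulVf.
rewrite expRM_natr.
have h : (1 + 8^-1) ^+ 8 <= expR 8^-1 ^+ 8 :> R.
  by apply: lerXn2r; rewrite ?nnegrE ?expR_ge0 ?expR_ge1Dx// addr_ge0.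
apply: le_trans h; rewrite !exprS expr0; lra.
Qed.

Lemma bernoulli_ineq (R : realDomainType) (x : R) (n : nat) : 0 <= x <= 1 ->
  1 - n%:R * x <= (1 - x) ^+ n.
Proof.
move=> /andP[x0 x1]; elim: n => [|n IH]; first by rewrite mul0r subr0 expr0.
have n0 : 0 <= n%:R :> R by [].
rewrite exprS -natr1; apply: (@le_trans _ _ ((1 - x) * (1 - n%:R * x))); first nra.
by apply: ler_wpM2l => //; rewrite subr_ge0.
Qed.

Lemma ffact_le_exp (n m : nat) : (n ^_ m <= n ^ m)%N.
Proof.
elim: m n => [|m IH] n; first by rewrite ffactn0 expn0.
rewrite ffactnS expnS leq_mul2l; apply/orP; right.
rewrite (leq_trans (IH _))//; case: m {IH} => // m.
by rewrite leq_exp2r// leq_pred.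
Qed.

(** From n^_d <= n^d and d! >= (d / e)^d, the latter because d^d / d! is a term of
    the series of exp d. *)
Lemma bin_le_exp (R : realType) (d q : nat) : (0 < d)%N ->
  'C(d + d * q, d)%:R <= (1 + q%:R) ^+ d * expR d%:R :> R.
Proof.
move=> d0.
have fact_gt : 0 < d`!%:R :> R by rewrite ltr0n fact_gt0.
have h1 : 'C(d + d * q, d)%:R * d`!%:R <= (d%:R * (1 + q%:R)) ^+ d :> R.
  rewrite -natrM bin_ffact mulrDr mulr1 -natrM -natrD -natrX ler_nat.
  exact: ffact_le_exp.
have h2 : d%:R ^+ d <= expR d%:R * d`!%:R :> R.
  rewrite -ler_pdivrMr//.
  have := expR_ge1Dxn d.-1 (ler0n R d); rewrite prednK//; lra.
rewrite -(ler_pM2r fact_gt) (le_trans h1)// exprMn mulrC -mulrA.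
by apply: ler_wpM2l => //; rewrite exprn_ge0// addr_ge0.
Qed.

Section Grid.
Context (R : realType) (d M : nat) (rho : R) (rho01 : 0 <= rho <= 1).

Definition grid : {set d.-tuple 'I_M.+1} :=
  [set t : d.-tuple 'I_M.+1 | (\sum_(i <- t) i <= M)%N]%SET.

Definition grid_upper (t : d.-tuple 'I_M.+1) : d.-tuple R :=
  [tuple rho ^+ tnth t j | j < d].

(** When the sum of the exponents is M, the upper box has volume rho^M and may be
    bracketed by the empty box; otherwise all exponents are incremented. *)
Definition grid_lower (t : d.-tuple 'I_M.+1) : d.-tuple R :=
  if (\sum_(i <- t) i)%N == M then [tuple of nseq d 0]
  else [tuple rho ^+ (tnth t j).+1 | j < d].

Lemma grid_upper_cube t : closed_unit_cube R d (grid_upper t).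
Proof.
case/andP: rho01 => r0 r1 j.
by rewrite tnth_mktuple exprn_ge0//= exprn_ile1.
Qed.

Lemma grid_lower_cube t : closed_unit_cube R d (grid_lower t).
Proof.
case/andP: rho01 => r0 r1 j; rewrite /grid_lower; case: ifP => _.
  by rewrite tnth_nseq lexx ler01.
by rewrite tnth_mktuple exprn_ge0//= exprn_ile1.
Qed.

(** Take t of largest sum with z <= rho^t.  If the sum is M, the volume is
    rho^M.  Otherwise no exponent can be incremented, hence rho^(t+1) <= z, and
    the volumes differ by the factor rho^d. *)
Lemma grid_bracket (delta : R) (z : d.-tuple R) :
  rho ^+ M <= delta -> 1 - rho ^+ d <= delta -> closed_unit_cube R d z ->
  exists2 t, t \in grid & [/\
    (forall j, tnth (grid_lower t) j <= tnth z j),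
    (forall j, tnth z j <= tnth (grid_upper t) j) &
    \prod_j tnth (grid_upper t) j - \prod_j tnth (grid_lower t) j <= delta].
Proof.
case/andP: rho01 => r0 r1 hM hd hz.
pose Q (t : d.-tuple 'I_M.+1) :=
  (t \in grid) && [forall j, tnth z j <= rho ^+ tnth t j].
pose total (t : d.-tuple 'I_M.+1) := (\sum_(j < d) tnth t j)%N.
have gridE (t : d.-tuple 'I_M.+1) : (\sum_(i <- t) i)%N = total t by rewrite big_tuple.
have Q0 : Q [tuple of nseq d ord0].
  rewrite /Q inE gridE /total big1 => [|j _]; last by rewrite tnth_nseq.
  by apply/forallP => j; rewrite tnth_nseq expr0; case/andP: (hz j).
case: (arg_maxnP total Q0) => t /andP[tg /forallP zt] tmax.
have upE : \prod_j tnth (grid_upper t) j = rho ^+ total t.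
  rewrite -prodrXr; apply: eq_bigr => j _; by rewrite tnth_mktuple.
exists t => //; rewrite /grid_lower gridE; case: eqP => tM; split.
- by move=> j; rewrite tnth_nseq; case/andP: (hz j).
- by move=> j; rewrite tnth_mktuple.
- rewrite upE tM lerBlDr (le_trans hM)// lerDl prodr_ge0// => j _.
  by rewrite tnth_nseq.
- move=> j; rewrite tnth_mktuple leNgt; apply/negP => zj.
  have tltM : (total t < M)%N.
    by move: tg; rewrite inE gridE leq_eqVlt => /orP[/eqP|].
  have tj : (tnth t j < M)%N.
    by rewrite (leq_ltn_trans _ tltM)// /total (bigD1 j)//= leq_addr.
  (* If z were below rho^(t+1) in coordinate j, incrementing t there would
     contradict maximality. *)
  pose t' := [tuple (if i == j then inord (tnth t i).+1 else tnth t i) | i < d].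
  have t'E i : tnth t' i = (tnth t i + (i == j))%N :> nat.
    rewrite tnth_mktuple; case: eqP => [->|_]; last by rewrite addn0.
    by rewrite inordK ?addn1.
  have totalE : total t' = (total t).+1.
    rewrite /total; under eq_bigr do rewrite t'E.
    rewrite big_split/= -[RHS]addn1; congr addn.
    rewrite (bigD1 j)//= eqxx big1 ?addn0// => i /negPf ->.
    by [].
  have : Q t'.
    rewrite /Q inE gridE totalE tltM/=; apply/forallP => i; rewrite t'E.
    by case: eqP => [->|_]; rewrite ?addn1 ?addn0 ?(ltW zj)// zt.
  by move/tmax; rewrite totalE /= ltnn.
- by move=> j; rewrite tnth_mktuple.
- rewrite upE (eq_bigr (fun j => rho ^+ tnth t j * rho)) => [|j _]; last first.
    by rewrite tnth_mktuple exprSr.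
  rewrite big_split/= prodr_const card_ord prodrXr -/(total t).
  rewrite -[X in X - _]mulr1 -mulrBr (le_trans _ hd)// ler_piMl ?exprn_ile1//.
  by rewrite subr_ge0 exprn_ile1.
Qed.

End Grid.

Definition volume {R : pzRingType} {d : nat} (z : d.-tuple R) : R := \prod_(j < d) tnth z j.

(** The endpoints of all brackets are gathered in one sequence, the range of the
    union bound in the chaining argument. *)
Record bracketing (R : realType) (d : nat) (delta : R) := Bracketing {
  points : seq (d.-tuple R);
  lower : d.-tuple R -> d.-tuple R;
  upper : d.-tuple R -> d.-tuple R;
  points_cube : forall z, z \in points -> closed_unit_cube R d z;
  bracketingP : forall z, closed_unit_cube R d z ->
    [/\ lower z \in points, upper z \in points,
     (forall j, tnth (lower z) j <= tnth z j), (forall j, tnth z j <= tnth (upper z) j) &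
     volume (upper z) - volume (lower z) <= delta]
}.
Arguments points {R d delta}.
Arguments lower {R d delta}.
Arguments upper {R d delta}.
Arguments points_cube {R d delta}.
Arguments bracketingP {R d delta}.

(** Passing from j to j + 1 multiplies the left-hand side by at most 6 < e^2. *)
Lemma grid_count_bound (R : realType) (j : nat) :
  1 + (4 ^ (5 + j) * (2 * (5 + j)))%:R <= expR (10 + 2 * j%:R) :> R.
Proof.
elim: j => [|j IH].
  rewrite mulr0 addr0 (_ : 10 = 1 * 10%:R); last by rewrite mul1r.
  rewrite expRM_natr.
  have h : (256 / 100) ^+ 10 <= expR 1 ^+ 10 :> R.
    by apply: lerXn2r; rewrite ?nnegrE ?expR_ge0 ?expR1_ge// divr_ge0.
  apply: le_trans h; rewrite addn0 natrM natrX !exprS expr0 !natrM; lra.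
have -> : 10 + 2 * j.+1%:R = (10 + 2 * j%:R) + 1 * 2%:R :> R by rewrite -natr1; ring.
rewrite expRD expRM_natr.
have e2 : 6 <= expR 1 ^+ 2 :> R by have := expR1_ge R; nra.
have h : 1 + (4 ^ (5 + j.+1) * (2 * (5 + j.+1)))%:R <=
    (1 + (4 ^ (5 + j) * (2 * (5 + j)))%:R) * 6 :> R.
  rewrite addnS expnS; move: (4 ^ (5 + j))%N => X.
  have Xj : 0 <= X%:R * j%:R :> R by rewrite -natrM.
  have X0 : 0 <= X%:R :> R by [].
  rewrite !natrM -[(5 + j).+1]addn1 !natrD; lra.
apply: (le_trans h); exact: ler_pM.
Qed.

(** With n = d 4^i and rho = 1 - 1/n, rho^d >= 1 - 4^-i by Bernoulli's inequality,
    and rho^n <= 1/e <= 1/2 makes M = 2 i n exponents enough for rho^M <= 4^-i. *)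
Lemma bracketing_cover (R : realType) (d j : nat) : (0 < d)%N ->
  exists c : bracketing R d (4^-1 ^+ (5 + j)),
    (size (points c))%:R <= 2 * expR ((11 + 2 * j%:R) * d%:R) :> R.
Proof.
move=> d0; set i := (5 + j)%N.
pose n := (d * 4 ^ i)%N; pose M := (d * (4 ^ i * (2 * i)))%N.
have n0 : (0 < n)%N by rewrite muln_gt0 d0 expn_gt0.
have nR : 0 < n%:R :> R by rewrite ltr0n.
pose rho : R := 1 - n%:R^-1.
have rn01 : 0 <= (n%:R^-1 : R) <= 1.
  by rewrite invr_ge0 ler0n invf_le1//= ler1n.
have rho01 : 0 <= rho <= 1 by rewrite /rho; case/andP: rn01 => *; lra.
have half : rho ^+ n <= 2^-1.
  have : rho ^+ n <= expR (- n%:R^-1) ^+ n.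
    by apply: lerXn2r; rewrite ?nnegrE ?expR_ge0 ?expR_ge1Dx//; case/andP: rho01.
  rewrite -expRM_natr mulNr mulVf ?gt_eqF// => /le_trans; apply.
  by rewrite expRN lef_pV2 ?posrE ?expR_gt0// (le_trans _ (expR1_ge R))//; lra.
have hM : rho ^+ M <= 4^-1 ^+ i.
  have -> : M = (n * 2 * i)%N by rewrite /M /n !mulnA.
  rewrite exprM; apply: lerXn2r; rewrite ?nnegrE ?exprn_ge0 ?invr_ge0//.
    by case/andP: rho01.
  rewrite exprM (_ : 4^-1 = 2^-1 ^+ 2); last by rewrite expr2; lra.
  by apply: lerXn2r => //; rewrite ?nnegrE ?exprn_ge0 ?invr_ge0//; case/andP: rho01.
have hd : 1 - rho ^+ d <= 4^-1 ^+ i.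
  have := bernoulli_ineq R (n%:R^-1) d rn01; rewrite -/rho.
  have -> : d%:R * n%:R^-1 = 4^-1 ^+ i :> R.
    by rewrite /n natrM natrX invfM mulrA divff ?mul1r ?exprVn// pnatr_eq0 -lt0n.
  lra.
pose G := enum (grid d M).
pose pts := map (grid_upper R d M rho) G ++ map (grid_lower R d M rho) G.
pose brk (z : d.-tuple R) (y : d.-tuple R * d.-tuple R) := closed_unit_cube R d z ->
  [/\ y.1 \in pts, y.2 \in pts, (forall j, tnth y.1 j <= tnth z j),
     (forall j, tnth z j <= tnth y.2 j) & volume y.2 - volume y.1 <= 4^-1 ^+ i].
have ex_brk z : exists y, brk z y.
  have [hz|hz] := pselect (closed_unit_cube R d z); last by exists (z, z).
  have [t tG [h1 h2 h3]] := grid_bracket R d M rho rho01 _ z hM hd hz.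
  exists (grid_lower R d M rho t, grid_upper R d M rho t) => _.
  split => //; rewrite mem_cat.
    by rewrite (map_f (grid_lower R d M rho)) ?orbT ?mem_enum.
  by rewrite (map_f (grid_upper R d M rho)) ?mem_enum.
have [f hf] := choice ex_brk.
have ptsP z : z \in pts -> closed_unit_cube R d z.
  rewrite mem_cat => /orP[] /mapP[t _ ->]; first exact: grid_upper_cube.
  exact: grid_lower_cube.
exists (Bracketing _ _ _ pts (fun z => (f z).1) (fun z => (f z).2) ptsP hf).
rewrite /= size_cat !size_map -cardE /grid card_partial_ord_partitions addnn -mul2n natrM.
rewrite ler_wpM2l//.
apply: (le_trans (bin_le_exp R d _ d0)).
have -> : (11 + 2 * j%:R) * d%:R = (10 + 2 * j%:R) * d%:R + d%:R :> R by ring.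
rewrite expRD ler_wpM2r ?expR_ge0// expRM_natr.
by apply: lerXn2r; rewrite ?nnegrE ?expR_ge0 ?addr_ge0 ?grid_count_bound.
Qed.

(** * Chaining *)

(** The point to which z is rounded at the next coarser level; below level 0
    stands the empty box. *)
Definition previous {R : realType} {d : nat} {dl : nat -> R}
    (c : forall j, bracketing R d (dl j)) (j : nat) (z : d.-tuple R) : d.-tuple R :=
  if j is j'.+1 then lower (c j') z else [tuple of nseq d 0].

Lemma origin_box_mono (R : realType) (d : nat) (a b : d.-tuple R) :
  (forall j, tnth a j <= tnth b j) -> origin_box a `<=` origin_box b.
Proof. by move=> ab x h j; have /andP[-> /lt_le_trans->] := h j. Qed.

Lemma origin_box0 (R : realType) (d : nat) : (0 < d)%N ->
  origin_box ([tuple of nseq d 0] : d.-tuple R) = set0.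
Proof.
case: d => // d _; apply/seteqP; split => x // /(_ ord0).
by rewrite tnth_nseq => /andP[/le_lt_trans h /h]; rewrite ltxx.
Qed.

Lemma volume0 (R : realType) (d : nat) : (0 < d)%N ->
  volume ([tuple of nseq d 0] : d.-tuple R) = 0.
Proof. by case: d => // d _; rewrite /volume big_ord_recl tnth_nseq mul0r. Qed.

Lemma closed_unit_cube0 (R : realType) (d : nat) :
  closed_unit_cube R d [tuple of nseq d 0].
Proof. by move=> j; rewrite tnth_nseq lexx ler01. Qed.

Lemma volume_mono (R : realType) (d : nat) (a b : d.-tuple R) :
  closed_unit_cube R d a -> (forall j, tnth a j <= tnth b j) -> volume a <= volume b.
Proof. by move=> ha ab; apply: ler_prod => j _; rewrite ab andbT; case/andP: (ha j). Qed.

Lemma previousP (R : realType) (d : nat) (dl : nat -> R)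
    (c : forall j, bracketing R d (dl j)) (j : nat) (z : d.-tuple R) :
  closed_unit_cube R d z ->
  closed_unit_cube R d (previous c j z) /\ (forall i, tnth (previous c j z) i <= tnth z i).
Proof.
move=> hz; case: j => [|j] /=.
  by split=> [|i]; [exact: closed_unit_cube0|rewrite tnth_nseq; case/andP: (hz i)].
by have [h1 _ h2 _ _] := bracketingP (c j) z hz; split=> //; apply: points_cube h1.
Qed.

Lemma volume_previous (R : realType) (d : nat) (dl : nat -> R)
    (c : forall j, bracketing R d (dl j)) (j : nat) (z : d.-tuple R) :
  closed_unit_cube R d z -> volume z - volume (previous c j.+1 z) <= dl j.
Proof.
move=> hz /=; have [_ _ _ h1 h2] := bracketingP (c j) z hz.
by apply: le_trans h2; rewrite lerD2r volume_mono.
Qed.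

Lemma local_discrepancyB (R : realType) (N d : nat) (x : 'I_N -> d.-tuple R)
    (a z : d.-tuple R) : (forall j, tnth a j <= tnth z j) ->
  local_discrepancy x z - local_discrepancy x a =
  N%:R^-1 * (\sum_(n < N) \1_(origin_box z `\` origin_box a) (x n)) -
  (volume z - volume a).
Proof.
move=> az; rewrite /local_discrepancy -/(volume z) -/(volume a).
rewrite [in LHS]opprD [in LHS]opprK addrACA.
congr (_ + _); last by rewrite opprB addrC.
rewrite -mulrBr -sumrB; congr (_ * _); apply: eq_bigr => n _.
rewrite !indicE in_setD.
case: (boolP (x n \in origin_box a)) => h /=; last by rewrite subr0 andbT.
by rewrite andbF mem_set ?subrr//; apply: origin_box_mono az _ _; exact: set_mem.
Qed.

(** Induction on the level bounds the local discrepancy at the grid points; an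
    arbitrary z lies between two points of level J, and both terms of the local
    discrepancy are monotone in z. *)
Lemma chaining (R : realType) (N d J : nat) (x : 'I_N -> d.-tuple R) (dl t : nat -> R)
    (c : forall j, bracketing R d (dl j)) : (0 < d)%N ->
  (forall j z, (j <= J)%N -> z \in points (c j) ->
    `|local_discrepancy x z - local_discrepancy x (previous c j z)| <= t j) ->
  forall z, closed_unit_cube R d z ->
    `|local_discrepancy x z| <= \sum_(j < J.+1) t j + dl J.
Proof.
move=> d0 ht.
have pt j z : (j <= J)%N -> z \in points (c j) ->
    `|local_discrepancy x z| <= \sum_(i < j.+1) t i.
  elim: j z => [|j IH] z jJ zj.
    rewrite big_ord1 -[local_discrepancy x z]subr0.
    have <- : local_discrepancy x [tuple of nseq d 0] = 0.
      rewrite /local_discrepancy -/(volume _) volume0// subr0 big1 ?mulr0// => n _.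
      by rewrite origin_box0// indic0.
    exact: (ht 0%N).
  rewrite big_ord_recr/= -(subrK (local_discrepancy x (previous c j.+1 z)) (local_discrepancy x z)).
  rewrite addrC (le_trans (ler_normD _ _))// lerD ?ht//.
  have zc := points_cube (c j.+1) z zj.
  by have [h1 _ _ _ _] := bracketingP (c j) z zc; apply: IH h1; exact: ltnW.
move=> z hz; have [h1 h2 h3 h4 h5] := bracketingP (c J) z hz.
have := pt J _ (leqnn J) h1; have := pt J _ (leqnn J) h2.
set a := lower _ _; set b := upper _ _; set T := \sum_(j < J.+1) t j.
have ca := points_cube _ _ h1; have cb := points_cube _ _ h2.
have vaz : volume a <= volume z by exact: volume_mono.
have vzb : volume z <= volume b by exact: volume_mono.
have emp (u v : d.-tuple R) : (forall j, tnth u j <= tnth v j) ->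
    N%:R^-1 * (\sum_(n < N) \1_(origin_box u) (x n)) <=
    N%:R^-1 * (\sum_(n < N) \1_(origin_box v) (x n)) :> R.
  move=> uv; apply: ler_wpM2l; first by rewrite invr_ge0.
  apply: ler_sum => n _; rewrite !indicE ler_nat.
  case: (boolP (x n \in origin_box u)) => // h.
  by rewrite mem_set//; apply: origin_box_mono uv _ _; exact: set_mem.
have := emp _ _ h3; have := emp _ _ h4.
rewrite /local_discrepancy -!/(volume _) -/a -/b; move: vaz vzb h5; rewrite -/a -/b.
rewrite !ler_norml => ? ? ? ? ? /andP[? ?] /andP[? ?]; apply/andP; split; lra.
Qed.

(** * Failure probability of one increment *)

Lemma union_bound (R : realType) (dT : measure_display) (T : measurableType dT)
    (P : probability T R) (I : eqType) (r : seq I) (B : I -> set T) (f : I -> R) :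
  (forall i, i \in r -> measurable (B i) /\ (P (B i) <= (f i)%:E)%E) ->
  measurable (\big[setU/set0]_(i <- r) B i) /\
  (P (\big[setU/set0]_(i <- r) B i) <= (\sum_(i <- r) f i)%:E)%E.
Proof.
elim: r => [|i r IH] h; first by rewrite !big_nil measure0.
have [|mr Pr] := IH; first by move=> j jr; apply: h; rewrite inE jr orbT.
have [mi Pi] := h i (mem_head _ _).
rewrite !big_cons; split; first exact: measurableU.
by rewrite (le_trans (measureU2 _ mi mr))// EFinD leeD.
Qed.

(** The deviation allowed at level j.  With kap = d / A it balances the variance
    term of Bernstein's bound, taken at the parameter l = 40 * 2^j * s, against an
    exponent of order A + j d; the term j d compensates the number of grid
    points at level j. *)
Definition chain_step {R : realFieldType} (s kap : R) (j : nat) : R :=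
  if j is 0%N then 12 / 5 * s else s * (24 + 3 * j%:R * kap) / (39 * 2 ^+ j).

Lemma uniform_box_diff (R : realType) (dT : measure_display) (T : measurableType dT)
    (P : probability T R) (d : nat) (X : {RV P >-> d.-tuple R}) (a z : d.-tuple R) :
  uniform_on_unit_cube X -> closed_unit_cube R d z -> closed_unit_cube R d a ->
  (forall j, tnth a j <= tnth z j) ->
  P (X @^-1` (origin_box z `\` origin_box a)) = (volume z - volume a)%:E.
Proof.
move=> uX hz ha az.
have mX w : measurable (X @^-1` origin_box w).
  rewrite -[X in measurable X]setTI.
  have mw := measurable_origin_box R d w.
  by apply: measurable_funP.
rewrite setDE preimage_setI -preimage_setC -setDE measureD//; last first.
  by rewrite ltey_eq fin_num_measure.
rewrite setIidr; last by move=> t; exact: origin_box_mono.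
rewrite /= (uniform_origin_box R dT T P d X z uX hz).
by rewrite (uniform_origin_box R dT T P d X a uX ha) -EFinB.
Qed.

(** Hoeffding's bound with l = 48/5 s at level 0, Bernstein's bound with
    l = 40 * 2^j * s at the later levels, where the variance is at most
    4^-(4+j), so that 2 p l^2 <= 25/2 s^2. *)
Lemma level_tail (R : realType) (d N k j : nat) (s kap : R)
    (c : forall j, bracketing R d (4^-1 ^+ (5 + j)))
    (dT : measure_display) (T : measurableType dT) (P : probability T R)
    (X : 'I_N -> {RV P >-> d.-tuple R}) (z : d.-tuple R) :
  (0 < d)%N -> (0 < N)%N -> 0 < s -> 0 <= kap -> ~~ odd k -> (0 < k)%N ->
  (0 < j)%N ==> (40 * 2 ^+ j * s <= 2^-1) ->
  99 * (N%:R * s ^+ 2 * (25 + 4 * j%:R * kap)) <= k%:R ->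
  kwise_independent k X -> (forall n, uniform_on_unit_cube (X n)) ->
  z \in points (c j) ->
  let B := [set t | chain_step s kap j <
    `|local_discrepancy (fun n => X n t) z
      - local_discrepancy (fun n => X n t) (previous c j z)|] in
  measurable B /\
  (P B <= (4 * expR (- (N%:R * s ^+ 2 * (45 / 4 + 3 * j%:R * kap))))%:E)%E.
Proof.
move=> d0 N0 s0 kap0 k_even k0 hl hk kX uX zj B.
have NR : 0 < N%:R :> R by rewrite ltr0n.
have hz := points_cube (c j) z zj.
have [ha az] := previousP R d _ c j z hz.
set a := previous c j z in ha az *.
pose D := origin_box z `\` origin_box a; pose p := volume z - volume a.
have mD : measurable D by apply: measurableD; exact: measurable_origin_box.
have pD n : P (X n @^-1` D) = p%:E by exact: uniform_box_diff.
have p0 : 0 <= p by rewrite subr_ge0 volume_mono.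
have vz1 : volume z <= 1 by have /andP[] := prod_01 _ _ (fun j => tnth z j) hz.
have va0 : 0 <= volume a by have /andP[] := prod_01 _ _ (fun j => tnth a j) ha.
have p01 : 0 <= p <= 1 by rewrite p0/= /p; lra.
pose l : R := if j is 0%N then 48 / 5 * s else 40 * 2 ^+ j * s.
pose b : R := if j is 0%N then l ^+ 2 / 8 else 25 / 2 * s ^+ 2.
pose tau := N%:R * chain_step s kap j.
have jk : 0 <= j%:R * kap by rewrite mulr_ge0.
have s2 : 0 < s ^+ 2 by rewrite exprn_gt0.
have l0 : 0 <= l by rewrite /l; case: (j) => [|j']; rewrite !mulr_ge0 ?exprn_ge0// ltW.
have step0 : 0 <= chain_step s kap j.
  rewrite /chain_step; case: (j) jk => [|j'] jk; first by rewrite mulr_ge0// ltW.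
  by rewrite divr_ge0 ?mulr_ge0 ?exprn_ge0 ?(ltW s0)// addr_ge0// -mulrA mulr_ge0.
have tau0 : 0 <= tau by rewrite mulr_ge0// ltW.
have ltauE : l * tau = N%:R * s ^+ 2 *
    (if j is 0%N then 576 / 25 else 40 / 39 * (24 + 3 * j%:R * kap)).
  rewrite /tau /l /chain_step; case: (j) => [|j']; first by field.
  by field; rewrite expf_neq0.
have Ns2 : 0 < N%:R * s ^+ 2 by rewrite mulr_gt0.
have ltau_le : 99 * (l * tau) <= k%:R.
  apply: le_trans hk; rewrite ler_pM2l// ltauE ler_pM2l//.
  case: (j) jk => [|j'] jk; first by rewrite mulr0 mul0r; lra.
  lra.
have mgf l' : `|l'| = l ->
    p * expR (l' * (1 - p)) + (1 - p) * expR (- (l' * p)) <= expR b.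
  move=> hl'; have sq : l' ^+ 2 = l ^+ 2 by rewrite -hl' real_normK ?num_real.
  rewrite /b; move: sq hl; rewrite /l; case Ej : (j) => [|j'] sq.
    by rewrite -sq => _; exact: hoeffding_bernoulli.
  move=> /= hl; apply: (le_trans (bernstein_bernoulli _ _ _ p01 _)).
    by apply: (le_trans (ler_norm _)); rewrite hl' /l Ej.
  rewrite ler_expR sq.
  have pj : p <= 4^-1 ^+ (5 + j').
    by rewrite /p /a Ej; apply: volume_previous.
  have pow : 4^-1 ^+ (5 + j') * (2 ^+ j'.+1) ^+ 2 = 256^-1 :> R.
    rewrite exprD (exprS 2 j') exprMn -(exprM 2 j') mulnC exprM mulrACA -exprMn.
    rewrite (_ : 4^-1 * 2 ^+ 2 = 1) ?expr1n; last by field.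
    by rewrite mulr1; field.
  have -> : 2 * p * (40 * 2 ^+ j'.+1 * s) ^+ 2 =
      3200 * s ^+ 2 * (p * (2 ^+ j'.+1) ^+ 2) by ring.
  have : p * (2 ^+ j'.+1) ^+ 2 <= 256^-1 by rewrite -pow ler_wpM2r// sqr_ge0.
  rewrite -(ler_pM2l s2); lra.
have [mB PB] := kwise_deviation_tail R dT T P _ _ _ X D k k p l b tau
  kX mD pD k_even (introT andP (conj k0 (leqnn k))) l0 tau0 ltau_le p01 mgf.
have BE : B = [set t | tau < `|\sum_i \1_D (X i t) - #|'I_N|%:R * p|].
  apply/funext => t; apply/propext; rewrite /B /= card_ord local_discrepancyB// -/D -/p.
  set S := \sum_(i < N) _.
  have -> : S - N%:R * p = N%:R * (N%:R^-1 * S - p).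
    by rewrite [RHS]mulrBr mulVKf// gt_eqF.
  by rewrite normrM (gtr0_norm NR) /tau ltr_pM2l.
rewrite BE; split => //; apply: (le_trans PB).
rewrite lee_fin ler_pM2l// ler_expR card_ord ltauE.
have -> : N%:R * b = N%:R * s ^+ 2 * (if j is 0%N then 288 / 25 else 25 / 2).
  by rewrite /b /l; case: (j) => [|j']; field.
rewrite [99 / 100 * _]mulrCA -mulrBr -[leRHS]mulrN ler_pM2l//.
case: (j) jk => [|j'] jk; first by rewrite mulr0 mul0r; lra.
lra.
Qed.

(** * Number of levels and sums over the levels *)

(** The partial sums of (24 + 3 j) / 2^j over j = 1 .. J are
    30 - (30 + 3 J) / 2^J. *)
Lemma chain_step_sum (R : realFieldType) (s kap : R) (J : nat) :
  0 <= s -> 0 <= kap <= 1 ->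
  \sum_(j < J.+1) chain_step s kap j <= (12 / 5 + 30 / 39) * s.
Proof.
move=> s0 /andP[kap0 kap1].
suff : \sum_(j < J.+1) chain_step s kap j <=
    s * (12 / 5 + 30 / 39 - (30 + 3 * J%:R) / (39 * 2 ^+ J)).
  move/le_trans; apply; rewrite mulrC ler_wpM2r// gerBl.
  by rewrite divr_ge0 ?mulr_ge0 ?exprn_ge0 ?addr_ge0 ?mulr_ge0.
elim: J => [|J IH].
  by rewrite big_ord1 /= mulr0 addr0 expr0 mulr1; lra.
rewrite big_ord_recr/=; apply: (le_trans (lerD IH (lexx _))).
have J0 : 0 <= J%:R :> R by [].
have p2 : 0 < 2 ^+ J :> R by rewrite exprn_gt0.
rewrite /chain_step exprS -[J.+1%:R]natr1.
have -> : s * (12 / 5 + 30 / 39 - (30 + 3 * (J%:R + 1)) / (39 * (2 * 2 ^+ J))) =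
    s * (12 / 5 + 30 / 39 - (30 + 3 * J%:R) / (39 * 2 ^+ J)) +
    s * (24 + 3 * (J%:R + 1)) / (39 * (2 * 2 ^+ J)).
  by field; rewrite gt_eqF.
rewrite lerD2l ler_pM2r ?invr_gt0 ?mulr_gt0//.
by rewrite ler_wpM2l// lerD2l ler_piMr// mulr_ge0// addr_ge0.
Qed.

(** Take the least J that reaches accuracy s/4: minimality gives the upper bound on
    s, which keeps the Bernstein parameter 40 * 2^j * s at most 1/2 for j <= J. *)
Lemma level_count_ex (R : realType) (s : R) : 0 < s ->
  exists J : nat, 4^-1 ^+ (5 + J) <= s / 4 /\ ((0 < J)%N ==> (s < 4^-1 ^+ (3 + J))).
Proof.
move=> s0.
have ex : exists J : nat, 4^-1 ^+ (4 + J) <= s.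
  have [n /ltW hn] : exists n : nat, s^-1 < n%:R.
    by exists (Num.truncn s^-1).+1; exact: truncnS_gt.
  exists n; rewrite exprVn invf_ple ?posrE ?exprn_gt0//.
  apply: (le_trans hn); rewrite -natrX ler_nat.
  by rewrite ltnW// (leq_trans (ltn_expl n (isT : 1 < 4)%N))// leq_exp2l// leq_addl.
exists (ex_minn ex); case: ex_minnP => J hJ Jmin; split.
  by rewrite -[(5 + J)%N]/(4 + J).+1 exprSr ler_wpM2r// invr_ge0.
case: J hJ Jmin => //= J _ Jmin; rewrite ltNge; apply/negP => h.
have /Jmin : 4^-1 ^+ (4 + J) <= s by move: h; rewrite -addSnnS.
by rewrite ltnn.
Qed.

(** The hypothesis gives 4^J <= 1 / eps, and e <= 4. *)
Lemma level_count_le (R : realType) (eps : R) (J : nat) : 0 < eps <= 1 ->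
  (0 < J)%N ==> (2 / 7 * eps < 4^-1 ^+ (3 + J)) -> J%:R <= ln eps^-1.
Proof.
move=> /andP[e0 e1]; case: J => [_|J /= h].
  by rewrite ln_ge0// invf_ge1.
rewrite -[leLHS]expRK ler_ln ?posrE ?expR_gt0 ?invr_gt0//.
have e4 : expR 1 <= 4 :> R.
  have -> : 1 = 2^-1 * 2%:R :> R by rewrite mulVf.
  rewrite expRM_natr.
  have := @expR_le_quad R 2^-1 (lexx _); have := expR_ge0 (2^-1 : R); nra.
rewrite -[J.+1%:R]mul1r expRM_natr.
apply: (@le_trans _ _ (4 ^+ J.+1)).
  by apply: lerXn2r; rewrite ?nnegrE ?expR_ge0.
rewrite invf_pge ?posrE ?exprn_gt0// -exprVn.
have w0 : 0 < 4^-1 ^+ J.+1 :> R by rewrite exprn_gt0// invr_gt0.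
move: h w0; rewrite exprD; move: (4^-1 ^+ J.+1) => w.
by rewrite !exprS expr0; lra.
Qed.

(** The number of grid points at level j costs (11 + 2 j) d in the exponent, less
    than the gain 45/4 q + 3 j q kap; the surplus, at least L + 22 + j, leaves
    summable failure probabilities. *)
Lemma level_sum_bound (R : realType) (d j n : nat) (L q kap : R) :
  (0 < d)%N -> 0 <= L -> d%:R + L + 2 <= q -> d%:R <= q * kap ->
  n%:R <= 2 * expR ((11 + 2 * j%:R) * d%:R) :> R ->
  n%:R * (4 * expR (- (q * (45 / 4 + 3 * j%:R * kap)))) <= expR (- L) * 2^-1 ^+ j.+1.
Proof.
move=> d0 L0 hq hk hn.
have d1 : 1 <= d%:R :> R by rewrite ler1n.
have j0 : 0 <= j%:R :> R by [].
apply: (le_trans (ler_wpM2r _ hn)); first by rewrite mulr_ge0 ?expR_ge0.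
rewrite mulrACA -expRD.
have h1 : expR ((11 + 2 * j%:R) * d%:R - q * (45 / 4 + 3 * j%:R * kap)) <=
    expR (- L) * (expR (- 22) * expR (- j%:R)) :> R.
  rewrite -!expRD ler_expR.
  have : j%:R * d%:R <= j%:R * (q * kap) by rewrite ler_wpM2l.
  have : j%:R <= j%:R * d%:R :> R by rewrite ler_peMr.
  nra.
apply: (@le_trans _ _ (2 * 4 * (expR (- L) * (expR (- 22) * expR (- j%:R))))).
  by rewrite ler_wpM2l// mulr_ge0.
rewrite mulrCA ler_wpM2l ?expR_ge0// mulrA exprS.
(* The factor 2 * 4 comes from the two endpoints of a bracket and from the
   tail bound. *)
have h22 : 2 * 4 * expR (- 22) <= 2^-1 :> R.
  rewrite expRN ler_pdivrMr ?expR_gt0//.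
  have := expR_ge1Dx (22 : R); lra.
have hj : expR (- j%:R) <= 2^-1 ^+ j :> R.
  rewrite -[j%:R]mul1r -mulNr expRM_natr expRN.
  apply: lerXn2r; rewrite ?nnegrE ?invr_ge0 ?expR_ge0//.
  by rewrite lef_pV2 ?posrE ?expR_gt0//; have := expR_ge1Dx (1 : R); lra.
by apply: ler_pM => //; rewrite ?mulr_ge0 ?expR_ge0.
Qed.

(** * The tail of the star discrepancy *)

(** Outside the union over all levels and grid points of the exceptional events,
    chaining applies with the steps [chain_step]; these add up to at most
    (12/5 + 30/39) s, and (12/5 + 30/39 + 1/4) s <= 7/2 s. *)
Lemma star_discrepancy_tail (R : realType) (d N k J : nat) (s kap L : R)
    (dT : measure_display) (T : measurableType dT) (P : probability T R)
    (X : 'I_N -> {RV P >-> d.-tuple R}) :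
  (0 < d)%N -> (0 < N)%N -> 0 < s -> 0 <= kap <= 1 -> ~~ odd k -> (0 < k)%N -> 0 <= L ->
  d%:R + L + 2 <= N%:R * s ^+ 2 -> d%:R <= N%:R * s ^+ 2 * kap ->
  4^-1 ^+ (5 + J) <= s / 4 -> (0 < J)%N ==> (s < 4^-1 ^+ (3 + J)) ->
  99 * (N%:R * s ^+ 2 * (25 + 4 * J%:R * kap)) <= k%:R ->
  kwise_independent k X -> (forall n, uniform_on_unit_cube (X n)) ->
  ((1 - expR (- L))%:E <= P [set t | (star_discrepancy (fun n => X n t) <= 7 / 2 * s)%R])%E.
Proof.
move=> d0 N0 s0 kap01 k_even k0 L0 hA hd hJ hJ' hk kX uX.
have /andP[kap0 kap1] := kap01.
have Ns2 : 0 <= N%:R * s ^+ 2 by rewrite mulr_ge0// sqr_ge0.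
pose c j := sval (cid (bracketing_cover R d j d0)).
have hc j : (size (points (c j)))%:R <= 2 * expR ((11 + 2 * j%:R) * d%:R) :> R.
  exact: svalP (cid (bracketing_cover R d j d0)).
pose B j z := [set t | chain_step s kap j <
    `|local_discrepancy (fun n => X n t) z
      - local_discrepancy (fun n => X n t) (previous c j z)|].
pose f j : R := 4 * expR (- (N%:R * s ^+ 2 * (45 / 4 + 3 * j%:R * kap))).
have tail j z : (j <= J)%N -> z \in points (c j) ->
    measurable (B j z) /\ (P (B j z) <= (f j)%:E)%E.
  move=> jJ zj; apply: (level_tail R d N k j s kap c dT T P X z) => //.
    apply/implyP => j0; have J0 : (0 < J)%N by exact: leq_trans jJ.
    move: hJ'; rewrite J0 /= => hs.
    have h2 : 2 ^+ j <= 2 ^+ J :> R by rewrite ler_weXn2l// ler1n.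
    have h3 : 2 ^+ j * s <= 2 ^+ J * 4^-1 ^+ (3 + J).
      by apply: ler_pM => //; rewrite ?exprn_ge0// ltW.
    have h4 : 2 ^+ J * 4^-1 ^+ (3 + J) <= 64^-1 * 2^-1 :> R.
      rewrite exprD mulrCA -exprMn (_ : 2 * 4^-1 = 2^-1); last by field.
      rewrite (_ : 4^-1 ^+ 3 = 64^-1); last by rewrite !exprS expr0; field.
      rewrite ler_wpM2l ?invr_ge0// -[leRHS]expr1 ler_wiXn2l ?invr_ge0//; lra.
    move: h3 h4; rewrite -mulrA; move: (_ * s) (_ * _ ^+ (3 + J)) => v w; lra.
  apply: le_trans hk; rewrite ler_pM2l// ler_wpM2l// lerD2l ler_wpM2r//.
  by rewrite ler_pM2l// ler_nat.
pose bad j := \big[setU/set0]_(z <- points (c j)) B j z.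
have level j : j \in iota 0 J.+1 -> measurable (bad j) /\
    (P (bad j) <= (expR (- L) * 2^-1 ^+ j.+1)%:E)%E.
  rewrite mem_iota /= add0n ltnS => jJ.
  have [mb Pb] := union_bound R dT T P _ (points (c j)) (B j) (fun=> f j) (fun z => tail j z jJ).
  split => //; apply: (le_trans Pb); rewrite lee_fin big_const_seq count_predT iter_addr_0.
  rewrite -[leLHS]mulr_natl; exact: (level_sum_bound _ _ _ _ _ _ _ d0 L0 hA hd (hc j)).
have [mbad Pbad] := union_bound R dT T P _ (iota 0 J.+1) bad _ level.
set total := \big[setU/set0]_(j <- _) _ in mbad Pbad.
have {}Pbad : (P total <= (expR (- L))%:E)%E.
  apply: (le_trans Pbad); rewrite lee_fin -mulr_sumr ler_piMr ?expR_ge0//.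
  have E n : \sum_(j <- iota 0 n) 2^-1 ^+ j.+1 = 1 - 2^-1 ^+ n :> R.
    elim: n => [|n IH]; first by rewrite big_nil expr0 subrr.
    by rewrite -addn1 iotaD big_cat /= big_seq1 add0n IH addn1 exprS; field.
  by rewrite E gerBl exprn_ge0// invr_ge0.
have good : ~` total `<=` [set t | star_discrepancy (fun n => X n t) <= 7 / 2 * s].
  move=> t nt /=; apply/star_discrepancy_leP => z hz.
  have := chaining R N d J (fun n => X n t) _ (chain_step s kap) c d0 _ z hz.
  move=> /(_ _) /le_trans; apply.
    move=> j y jJ yj; rewrite leNgt; apply/negP => By; apply: nt.
    rewrite /total -bigcup_seq; exists j.
      by have : j \in iota 0 J.+1 by rewrite mem_iota.
    by rewrite /bad -bigcup_seq; exists y.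
  have := chain_step_sum R s kap J (ltW s0) kap01; move: hJ; lra.
have mE := measurable_star_discrepancy_le R dT T N d X (7 / 2 * s).
have : (P (~` total) <= P [set t | (star_discrepancy (fun n => X n t) <= 7 / 2 * s)%R])%E.
  by apply: le_measure => //; rewrite inE//; exact: measurableC.
apply: le_trans; rewrite probability_setC// EFinB leeB//.
Qed.

(** * The probabilistic discrepancy bound *)

Lemma absz_ceil_itv (R : realType) (y : R) : 0 < y ->
  y <= `|Num.ceil y|%N%:R <= y + 1.
Proof.
move=> y0; rewrite natr_absz gtr0_norm ?ceil_gt0// ceil_ge/=.
by have := ceilB1_lt y; rewrite rmorphB/= ltrBlDr => /ltW.
Qed.

Theorem corollary3p3 (R : realType) :
  exists (c : R) (CN Ck : R -> R), 0 < c /\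
    forall (d : nat) (eps u : R),
      (1 <= d)%N -> 0 < eps <= 1 -> 0 < u < 1 ->
      let N := num_points d eps u in
      (exists k : nat,
        [/\ (1 <= k)%N,
            k%:R <= c * (d%:R * (1 + ln (eps^-1)) + ln ((1 - u)^-1)),
            (forall (dT : measure_display) (T : measurableType dT)
                    (P : probability T R) (X : 'I_N -> {RV P >-> d.-tuple R}),
               kwise_independent k X ->
               (forall n : 'I_N, uniform_on_unit_cube (X n)) ->
               let E := [set t | star_discrepancy (fun n => X n t) <= eps] in
               measurable E /\ (u%:E <= P E)%E)
          & k%:R <= Ck u * (d%:R * (1 + ln (eps^-1)))])
      /\ N%:R <= CN u * (d%:R * eps ^- 2).
Proof.
pose logU (u : R) := ln (1 - u)^-1.
exists (150 * 100), (fun u => 49 / 4 * (3 + logU u) + 1), (fun u => 150 * 100 * (1 + logU u)).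
split; first by rewrite mulr_gt0.
move=> d eps u d0 /andP[e0 e1] /andP[u0 u1] N.
have d1 : 1 <= d%:R :> R by rewrite ler1n.
have e2 : 0 < eps ^+ 2 by rewrite exprn_gt0.
set L := ln (1 - u)^-1.
have L0 : 0 <= L by rewrite ln_ge0// invf_ge1; lra.
have expL : expR (- L) = 1 - u.
  by rewrite /L expRN lnK ?posrE ?invr_gt0 ?subr_gt0// invrK.
set l := ln eps^-1.
have l0 : 0 <= l by rewrite ln_ge0// invf_ge1.
have dl0 : 0 <= d%:R * l by rewrite mulr_ge0.
pose A := d%:R + L + 2.
have A3 : 3 <= A by rewrite /A; lra.
have A0 : 0 < A by lra.
pose y := 49%:R / 4%:R * A * eps ^- 2.
have NE : N = `|Num.ceil y|%N by rewrite /N /num_points -/L /y /A addrAC.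
have y0 : 0 < y by rewrite /y !mulr_gt0 ?invr_gt0 ?ltr0n.
have /andP[yN Ny] := absz_ceil_itv R y y0; rewrite -NE in yN Ny.
have N0 : (0 < N)%N by rewrite -(ltr0n R) (lt_le_trans y0).
split; last first.
  have ev : 1 <= d%:R * eps ^- 2.
    have h : 1 <= eps ^- 2 by rewrite invf_ge1// exprn_ile1// ltW.
    by rewrite -[leLHS]mulr1; apply: ler_pM.
  apply: (le_trans Ny); cbv beta.
  rewrite mulrDl mul1r lerD// /y mulrA ler_wpM2r ?invr_ge0 ?(ltW e2)//.
  rewrite -[leRHS]mulrA ler_wpM2l ?divr_ge0//.
  rewrite /A /logU -/L; have := ler_peMl L0 d1; lra.
pose H := d%:R * (1 + l) + L.
have H1 : 1 <= H by rewrite /H; lra.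
(* The tail bound needs an even degree of at least 99 times the largest
   Chernoff exponent, and 150 H exceeds all of these exponents. *)
pose k := (2 * `|Num.ceil (75 * 99 * H)|)%N.
have H0 : 0 < 75 * 99 * H by lra.
have /andP[Hk kH] := absz_ceil_itv R _ H0.
have kE : k%:R = 2 * `|Num.ceil (75 * 99 * H)|%N%:R :> R by rewrite /k natrM.
have k_ge : 99 * (150 * H) <= k%:R by rewrite kE; lra.
have k_le : k%:R <= 150 * 100 * H by rewrite kE; lra.
have k0 : (0 < k)%N by rewrite -(ltr0n R) (lt_le_trans _ k_ge)//; lra.
exists k; split => //; last first.
  apply: (le_trans k_le); cbv beta; rewrite -[leRHS]mulrA ler_pM2l ?mulr_gt0// /H -/L /logU -/L.
  have : L <= d%:R * (1 + l) * L by rewrite ler_peMl//; lra.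
  lra.
move=> dT T P X kX uX E; split; first exact: measurable_star_discrepancy_le.
pose s := 2 / 7 * eps.
have s0 : 0 < s by rewrite /s; lra.
have [J [hJ hJ']] := level_count_ex R s s0.
have Jl : J%:R <= l by apply: level_count_le hJ'; rewrite e0.
(* The constant 49/4 = (7/2)^2 in the number of points serves for this identity. *)
have ys : y * s ^+ 2 = A by rewrite /y /s; field; rewrite gt_eqF.
have s2 : s ^+ 2 <= 1 by rewrite exprn_ile1// /s; lra.
have s2' : 0 < s ^+ 2 by rewrite exprn_gt0.
have hA : A <= N%:R * s ^+ 2 by rewrite -ys ler_wpM2r// ltW.
have qA : N%:R * s ^+ 2 <= 4 / 3 * A.
  apply: (@le_trans _ _ ((y + 1) * s ^+ 2)); first by rewrite ler_wpM2r// ltW.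
  rewrite mulrDl ys; lra.
pose kap := d%:R / A.
have kapA : A * kap = d%:R by rewrite /kap mulrC divfK// gt_eqF.
have kap01 : 0 <= kap <= 1.
  rewrite /kap divr_ge0 ?(ltW A0)//= ler_pdivrMr// mul1r /A; lra.
have kap0 : 0 <= kap by case/andP: kap01.
have hd : d%:R <= N%:R * s ^+ 2 * kap by rewrite -kapA ler_wpM2r.
have hk : 99 * (N%:R * s ^+ 2 * (25 + 4 * J%:R * kap)) <= k%:R.
  apply: le_trans k_ge; rewrite ler_pM2l//.
  apply: (@le_trans _ _ (4 / 3 * A * (25 + 4 * J%:R * kap))).
    by rewrite ler_wpM2r// addr_ge0// mulr_ge0// mulr_ge0.
  have -> : 4 / 3 * A * (25 + 4 * J%:R * kap) = 4 / 3 * (25 * A + 4 * J%:R * (A * kap)).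
    by ring.
  have : J%:R * d%:R <= l * d%:R by rewrite ler_wpM2r.
  rewrite kapA /H /A; lra.
have k_even : ~~ odd k by rewrite /k oddM.
have := star_discrepancy_tail R d N k J s kap L dT T P X d0 N0 s0 kap01 k_even k0 L0
  hA hd hJ hJ' hk kX uX.
have -> : 7 / 2 * s = eps by rewrite /s; field.
by rewrite expL opprB addrC subrK.
Qed.
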